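(* Let $g_1,g_2:[0,1]\to[0,1]$ be firm carcass maps. Then $g_1$ and $g_2$ are topologically conjugate, and moreover each of them is topologically conjugate to the tent map $x\mapsto 2x$ for $0\le x\le 1/2$, $x\mapsto 2-2x$ for $1/2\le x\le 1$. Furthermore, for every $n\ge 1$ let $h_n:[0,1]\to[0,1]$ be the increasing piecewise linear map such that $h_n(g_1^{-n}(0))=g_2^{-n}(0)$ and all kinks of $h_n$ belong to $g_1^{-n}(0)$. Then the pointwise limit $h=\lim_{n\to\infty}h_n$ exists and is a homeomorphism of $[0,1]$ satisfying $h\circ g_1=g_2\circ h$.
   Context: A unimodal map is a continuous map $g:[0,1]\to[0,1]$ for which there is $v\in(0,1)$ such that $g$ is strictly increasing on $[0,v]$, strictly decreasing on $[v,1]$, and $g(0)=g(1)=0$, $g(v)=1$. Write $g^n$ for the $n$-th iterate, $g^{-n}(0)=\{x\in[0,1]:g^n(x)=0\}$ (a set of exactly $2^{n-1}+1$ points, containing $0$ and $1$), and $g^{-\infty}(0)=\bigcup_{n\ge1}g^{-n}(0)$, the complete pre-image of $0$. A map is piecewise linear if its domain can be divided into finitely many intervals on each of which its graph is a line segment; a kink is a point where a piecewise linear map is not differentiable (interior points of $[0,1]$ are meant). The maps $h_n$ are continuous. A carcass map is a piecewise linear unimodal map; a firm carcass map is a carcass map all of whose kinks belong to $g^{-\infty}(0)$. Two maps $g_1,g_2$ of $[0,1]$ are topologically conjugate if there is a homeomorphism $h:[0,1]\to[0,1]$ with $h\circ g_1=g_2\circ h$. *)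

(* Defs.v *)
From HB Require Import structures.
From mathcomp Require Import all_boot all_order all_algebra.
From mathcomp Require Import all_classical all_reals all_analysis.

Set Implicit Arguments.
Unset Strict Implicit.
Unset Printing Implicit Defensive.

Import Order.TTheory GRing.Theory Num.Theory numFieldNormedType.Exports.

Local Open Scope classical_set_scope.
Local Open Scope ring_scope.

(* A map [0,1] -> [0,1] is represented by a function R -> R that sends [0,1]
   into [0,1]; no definition below depends on its values outside [0,1]. *)

Section UnitIntervalMaps.
Variable R : realType.
Implicit Types (f g h : R -> R) (n : nat).

Definition unit_self_map f : Prop := set_fun `[0, 1] `[0, 1] f.

Definition continuous01 f : Prop := {within `[0, 1], continuous f}.

Definition strictly_increasing_on (A : set R) f : Prop :=
  forall x y, A x -> A y -> x < y -> f x < f y.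

Definition strictly_decreasing_on (A : set R) f : Prop :=
  forall x y, A x -> A y -> x < y -> f y < f x.

Definition unimodal g : Prop :=
  [/\ unit_self_map g, continuous01 g &
      exists v : R,
        [/\ 0 < v < 1,
            strictly_increasing_on `[0, v] g,
            strictly_decreasing_on `[v, 1] g,
            g 0 = 0 /\ g 1 = 0 &
            g v = 1]].

(* Any division of [0,1] into finitely many intervals can be refined to one
   into the open cells and the points of a subdivision
   0 = t_0 < t_1 < ... < t_k = 1, so only the open cells carry a condition.
   Continuity is not part of this definition. *)
Definition piecewise_linear f : Prop :=
  exists2 s : seq R, itv_partition 0 1 s &
    forall i, (i < size s)%N ->
      exists a b : R,
        forall x : R, nth 0 (0 :: s) i < x < nth 0 (0 :: s) i.+1 -> f x = a * x + b.

Definition kink f (x : R) : Prop := 0 < x < 1 /\ ~ derivable f x 1.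

Definition zero_preimage g n : set R :=
  [set x | x \in `[0, 1] /\ iter n g x = 0].

Definition complete_zero_preimage g : set R :=
  \bigcup_(n in [set n | (1 <= n)%N]) zero_preimage g n.

Definition carcass_map g : Prop := unimodal g /\ piecewise_linear g.

Definition firm_carcass_map g : Prop :=
  carcass_map g /\ kink g `<=` complete_zero_preimage g.

Definition homeomorphism01 h : Prop :=
  [/\ unit_self_map h, continuous01 h &
      exists k : R -> R,
        [/\ unit_self_map k, continuous01 k,
            {in `[0, 1], cancel h k} & {in `[0, 1], cancel k h}]].

Definition semiconj01 h g1 g2 : Prop :=
  {in `[0, 1], forall x, h (g1 x) = g2 (h x)}.

Definition topologically_conjugate g1 g2 : Prop :=
  exists2 h, homeomorphism01 h & semiconj01 h g1 g2.

Definition tent (x : R) : R := if x <= 1 / 2 then 2 * x else 2 - 2 * x.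

(* The maps h_n are the h with [approx_conj g1 g2 n h]. *)
Definition approx_conj g1 g2 n h : Prop :=
  [/\ unit_self_map h /\ continuous01 h,
      strictly_increasing_on `[0, 1] h,
      piecewise_linear h,
      h @` zero_preimage g1 n = zero_preimage g2 n &
      kink h `<=` zero_preimage g1 n].

End UnitIntervalMaps.

(* Main.v *)
Require Import Defs.
From HB Require Import structures.
From mathcomp Require Import all_boot all_order all_algebra.
From mathcomp Require Import all_classical all_reals all_analysis.
From mathcomp Require Import ring lra zify.

Import Order.TTheory GRing.Theory Num.Theory numFieldNormedType.Exports.

Local Open Scope classical_set_scope.
Local Open Scope ring_scope.


(** The idea is that a firm carcass map is a Markov map, so that its zero
    pre-images become dense, and that the combinatorics of the zero pre-images
    is that of the tent map.

    Any unimodal g has two inverse branches.  Pulling 0 and 1 back through them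
    enumerates g^-(m+1)(0) increasingly as nodes p m 0 < ... < p m (2^m), and
    one has g (p (m+1) k) = p m k' where k' is the image of k under an integer
    tent map (map_node), and p (m+1) (2k) = p m k (node_refine).  This holds
    for every unimodal map, so the nodes of two unimodal maps correspond
    to each other, with their order and their dynamics.  Sending a point to
    the point with the same position relative to all nodes is a conjugacy as
    soon as the points are determined by these positions, that is, as soon as
    the cells between consecutive nodes shrink to points for both maps.

    For a firm carcass map all kinks are nodes of a single level N, so g is
    affine on every cell of level m >= N.  A cell of level m+1 > N is mapped
    affinely onto a cell of level m and its splitting node onto the splitting
    node, so that both are split in the same ratio (split_ratio_pullback).
    Hence only the finitely many ratios of levels up to N ever occur; they are
    bounded by some r < 1, and a cell of level m has length at most r^m
    (affine_vanishing_mesh).  The tent map is affine on the cells of level 1,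
    so the same estimate applies to it.

    Finally, h_(m+1) has to match the nodes of level m in order
    (approx_conj_node) and to be affine on each cell, so it is the
    interpolation of this matching; it then matches the nodes of all lower
    levels too, which keeps h_n x, for n > m, in the same cell of level m as
    the image of x under the conjugacy (node_matching_cvg). *)

Set Implicit Arguments.
Unset Strict Implicit.

(** * Zero pre-images of a unimodal map *)

Section Nodes.
Context {R : realType}.
Implicit Types (g : R -> R) (v x y : R) (m k : nat).

(** The turning point is a parameter, because the two inverse branches depend
    on it. *)
Definition unimodal_at g v : Prop :=
  [/\ unit_self_map g, continuous01 g,
      0 < v < 1 /\ [/\ g 0 = 0, g 1 = 0 & g v = 1],
      strictly_increasing_on `[0, v] g &
      strictly_decreasing_on `[v, 1] g].

Definition lap v (right : bool) : set R :=
  if right then [set` `[v, 1]] else [set` `[0, v]].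

Definition inverse_branch g v right y : R :=
  xget 0 [set x | lap v right x /\ g x = y].

(** The k-th point of g^-(m+1)(0), for k <= 2^m: level 0 consists of 0 and 1,
    the lower half of level m+1 is level m seen through the increasing branch,
    and the upper half is level m, reversed, seen through the decreasing one. *)
Fixpoint node g v m k : R :=
  if m is m'.+1 then
    if (k <= 2 ^ m')%N then inverse_branch g v false (node g v m' k)
    else inverse_branch g v true (node g v m' (2 ^ m - k))
  else k%:R.

(** The action of the map on the nodes of level m+1 and on the cells of level
    m+1, where cell k lies between the nodes k and k+1. *)
Definition tent_index m k : nat := if (k <= 2 ^ m)%N then k else (2 ^ m.+1 - k)%N.

Definition tent_cell m k : nat := if (k < 2 ^ m)%N then k else (2 ^ m.+1 - k.+1)%N.

Definition in_cell g v m k x : Prop := node g v m k <= x <= node g v m k.+1.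

Lemma unimodalP g : unimodal g -> exists v, unimodal_at g v.
Proof.
by move=> [gI gc [v [v01 incg decg [g0 g1] gv]]]; exists v; split.
Qed.

Context {g : R -> R} {v : R} (gv : unimodal_at g v).
Local Notation p := (node g v).

Lemma lap_sub01 b x : lap v b x -> 0 <= x <= 1.
Proof.
have [_ _ [/andP[v0 v1] _] _ _] := gv.
by case: b; rewrite /= in_itv /= => /andP[? ?]; apply/andP; split; lra.
Qed.

(** The default value of the choice is never met, by the intermediate value
    theorem. *)
Lemma inverse_branchP b y : 0 <= y <= 1 ->
  lap v b (inverse_branch g v b y) /\ g (inverse_branch g v b y) = y.
Proof.
have [gI gc [/andP[v0 v1] [g0 g1 gv1]] incg decg] := gv.
move=> /andP[y0 y1].
have sub : lap v b `<=` `[0, 1].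
  by move=> x /lap_sub01; rewrite /= in_itv.
have cont : {within lap v b, continuous g} by exact: continuous_subspaceW sub gc.
suff [c cb gcy] : exists2 c, lap v b c & g c = y.
  by apply: (@xgetPex _ 0 [set x | lap v b x /\ g x = y]); exists c.
case: b cont {sub} => /= cont; apply: IVT => //; try exact: ltW;
  rewrite ?g0 ?g1 gv1; rewrite ge_min le_max y0 y1 ?orbT //.
Qed.

Lemma lap_inj b x y : lap v b x -> lap v b y -> g x = g y -> x = y.
Proof.
have [_ _ _ incg decg] := gv.
move=> xb yb gxy; case: (ltgtP x y) => // xy; case: b xb yb => xb yb.
- by have := decg _ _ xb yb xy; rewrite gxy ltxx.
- by have := incg _ _ xb yb xy; rewrite gxy ltxx.
- by have := decg _ _ yb xb xy; rewrite gxy ltxx.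
- by have := incg _ _ yb xb xy; rewrite gxy ltxx.
Qed.

Lemma inverse_branchK b x : lap v b x -> inverse_branch g v b (g x) = x.
Proof.
move=> xb; have [gI _ _ _ _] := gv.
have gx01 : 0 <= g x <= 1.
  by have := gI x; rewrite /= !in_itv /=; apply; exact: lap_sub01 xb.
have [lx ex] := inverse_branchP b gx01.
exact: lap_inj lx xb ex.
Qed.

Lemma pow2S m : (2 ^ m.+1 = 2 ^ m + 2 ^ m)%N.
Proof. by rewrite expnS mul2n addnn. Qed.

Lemma tent_index_le m k : (k <= 2 ^ m.+1)%N -> (tent_index m k <= 2 ^ m)%N.
Proof. by rewrite /tent_index pow2S; case: ifP; lia. Qed.

Lemma nodeS m k : p m.+1 k = inverse_branch g v (2 ^ m < k)%N (p m (tent_index m k)).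
Proof. by rewrite /= /tent_index ltnNge; case: ifP. Qed.

Lemma node0 k : p 0 k = k%:R.
Proof. by []. Qed.

(* Otherwise simplification would replace every node of positive level by its
   case distinction. *)
#[global] Arguments node : simpl never.

Lemma node01 m k : (k <= 2 ^ m)%N -> 0 <= p m k <= 1.
Proof.
elim: m k => [|m IH] k.
  by rewrite expn0; case: k => [|[|//]] _; rewrite node0 ?mulr0n ?mulr1n ?lexx ?ler01.
move=> kM; rewrite nodeS.
by have [/lap_sub01] := inverse_branchP (2 ^ m < k)%N (IH _ (tent_index_le kM)).
Qed.

Lemma node_lap m k : (k <= 2 ^ m.+1)%N -> lap v (2 ^ m < k)%N (p m.+1 k).
Proof.
move=> kM; rewrite nodeS.
by have [] := inverse_branchP (2 ^ m < k)%N (node01 (tent_index_le kM)).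
Qed.

Lemma map_node m k : (k <= 2 ^ m.+1)%N -> g (p m.+1 k) = p m (tent_index m k).
Proof.
move=> kM; rewrite nodeS.
by have [] := inverse_branchP (2 ^ m < k)%N (node01 (tent_index_le kM)).
Qed.

Lemma node_first_last m : p m 0 = 0 /\ p m (2 ^ m) = 1.
Proof.
have [_ _ [/andP[v0 v1] [g0 g1 gv1]] _ _] := gv.
have v0' := ltW v0; have v1' := ltW v1.
elim: m => [|m [IH0 IH1]]; first by rewrite expn0 !node0 mulr0n mulr1n.
rewrite !nodeS /tent_index leq0n ltn0 IH0 pow2S.
have h : (0 < 2 ^ m)%N by rewrite expn_gt0.
have -> : (2 ^ m < 2 ^ m + 2 ^ m)%N by lia.
have -> : (2 ^ m + 2 ^ m <= 2 ^ m)%N = false by lia.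
rewrite subnn IH0; split.
- by rewrite -{1}g0 inverse_branchK //= in_itv /= lexx v0'.
- by rewrite -{1}g1 inverse_branchK //= in_itv /= lexx v1'.
Qed.

Lemma node_middle m : p m.+1 (2 ^ m) = v.
Proof.
have [_ _ [/andP[v0 v1] [g0 g1 gv1]] _ _] := gv.
rewrite nodeS /tent_index leqnn ltnn (proj2 (node_first_last m)).
by rewrite -gv1 inverse_branchK //= in_itv /= lexx (ltW v0).
Qed.

(** The middle node is the turning point and belongs to both laps, which lets
    a cell next to it be treated inside a single lap. *)
Lemma node_lapW m k b :
  (k <= 2 ^ m.+1)%N -> (if b then 2 ^ m <= k else k <= 2 ^ m)%N -> lap v b (p m.+1 k).
Proof.
move=> kM; have [_ _ [/andP[/ltW v0 /ltW v1] _] _ _] := gv.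
case: (ltngtP k (2 ^ m)%N) => [kl|kr|->].
- by case: b => // _; have := node_lap kM; rewrite ltnNge (ltnW kl).
- by case: b => // _; have := node_lap kM; rewrite kr.
- by rewrite node_middle; case: b => _; rewrite /= in_itv /= lexx ?v0 ?v1.
Qed.

(** Both ends of a cell lie in one lap, where the order of two points is read
    off from the order of their images, which are neighbours one level below. *)
Lemma node_ltS m k : (k < 2 ^ m)%N -> p m k < p m k.+1.
Proof.
have [_ _ [/andP[v0 v1] _] incg decg] := gv.
elim: m k => [|m IH] k.
  by rewrite expn0; case: k => // _; rewrite !node0 mulr0n mulr1n ltr01.
move=> kM; rewrite ltNge; apply/negP => le1.
case: (ltnP k (2 ^ m)%N) => km.
- have l0 : lap v false (p m.+1 k) by apply: node_lapW => //; lia.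
  have l1 : lap v false (p m.+1 k.+1) by apply: node_lapW => //; lia.
  have : g (p m.+1 k) < g (p m.+1 k.+1).
    rewrite !map_node //; try lia.
    by rewrite /tent_index km (ltnW km) IH.
  move: le1; rewrite le_eqVlt => /orP[/eqP -> |]; first by rewrite ltxx.
  by move=> /(incg _ _ l1 l0) h /(lt_trans h); rewrite ltxx.
- have l0 : lap v true (p m.+1 k) by apply: node_lapW => //; lia.
  have l1 : lap v true (p m.+1 k.+1) by apply: node_lapW => //; lia.
  have : g (p m.+1 k.+1) < g (p m.+1 k).
    rewrite !map_node //; try lia.
    have -> : tent_index m k = (tent_index m k.+1).+1.
      rewrite /tent_index; move: kM km; rewrite pow2S => kM km.
      by case: ifP; case: ifP; lia.
    by apply: IH; rewrite /tent_index; move: kM km; rewrite pow2S; case: ifP; lia.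
  move: le1; rewrite le_eqVlt => /orP[/eqP -> |]; first by rewrite ltxx.
  by move=> /(decg _ _ l1 l0) h /(lt_trans h); rewrite ltxx.
Qed.

Lemma node_lt m i j : (i < j)%N -> (j <= 2 ^ m)%N -> p m i < p m j.
Proof.
elim: j => // j IH; rewrite ltnS leq_eqVlt => /orP[/eqP -> | ij] jM.
  exact: node_ltS.
by apply: lt_trans (node_ltS jM); apply: IH => //; exact: ltnW.
Qed.

Lemma node_le m i j : (i <= 2 ^ m)%N -> (j <= 2 ^ m)%N ->
  (p m i <= p m j) = (i <= j)%N.
Proof.
move=> iM jM; case: (ltngtP i j) => [ij|ji|->]; last by rewrite lexx.
- by rewrite ltW // node_lt.
- by rewrite leNgt node_lt.
Qed.

(** The next level keeps every node and adds one in each cell: at level 1 the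
    nodes 0 and 1 are still there, and the inverse branches transport this
    inclusion to all levels. *)
Lemma node_refine m k : (k <= 2 ^ m)%N -> p m.+1 k.*2 = p m k.
Proof.
elim: m k => [|m IH] k.
  rewrite expn0; case: k => [|[|//]] _.
    exact: (proj1 (node_first_last 1)).
  exact: (proj2 (node_first_last 1)).
move=> kM; rewrite nodeS [RHS]nodeS.
have -> : (2 ^ m.+1 < k.*2)%N = (2 ^ m < k)%N by rewrite pow2S; lia.
congr (inverse_branch _ _ _ _); rewrite -IH ?tent_index_le //.
congr (node _ _ _ _); rewrite /tent_index !pow2S.
have -> : (k.*2 <= 2 ^ m + 2 ^ m)%N = (k <= 2 ^ m)%N by lia.
by case: ifP; lia.
Qed.

Lemma node_refine_iter m d k : (k <= 2 ^ m)%N -> p (m + d) (2 ^ d * k) = p m k.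
Proof.
elim: d => [|d IH] kM; first by rewrite addn0 mul1n.
rewrite addnS pow2S mulnDl addnn node_refine; first exact: IH.
by rewrite expnD mulnC leq_mul2r kM orbT.
Qed.

Lemma zero_preimage_nodes m x :
  zero_preimage g m.+1 x <-> exists2 k, (k <= 2 ^ m)%N & x = p m k.
Proof.
have [gI _ [/andP[v0 v1] [g0 g1 _]] incg decg] := gv.
have v0' := ltW v0; have v1' := ltW v1.
have lapP y : 0 <= y <= 1 -> exists b, lap v b y.
  move=> /andP[y0 y1]; case: (leP y v) => yv; [exists false|exists true] => /=;
  by rewrite in_itv /= ?y0 ?y1 // ltW.
elim: m x => [|m IH] x; rewrite /zero_preimage /= in_itv /=; split.
- move=> [/lapP[[]] xb gx0].
    exists 1%N; rewrite // node0 mulr1n; apply: lap_inj xb _ _; last by rewrite g1.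
    by rewrite /= in_itv /= v1' lexx.
  exists 0%N; rewrite // node0 mulr0n; apply: lap_inj xb _ _; last by rewrite g0.
  by rewrite /= in_itv /= v0' lexx.
- by rewrite expn0 => -[[|[|//]] _ ->]; rewrite /= node0 ?mulr0n ?mulr1n lexx ler01.
- move=> [x01]; rewrite -/(iter m.+2 g x) iterSr => gx0.
  have gx01 : 0 <= g x <= 1 by have := gI x; rewrite /= !in_itv /=; apply.
  have /IH[k kM gxk] : zero_preimage g m.+1 (g x) by split; rewrite /= ?in_itv.
  have [b xb] := lapP _ x01.
  exists (if b then 2 ^ m.+1 - k else k)%N.
    by case: b {xb}; rewrite ?pow2S; lia.
  apply: (lap_inj xb).
    by apply: node_lapW; case: b {xb}; rewrite ?pow2S; lia.
  rewrite map_node; last by case: b {xb}; rewrite ?pow2S; lia.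
  rewrite gxk; congr (node _ _ _ _); rewrite /tent_index; case: b {xb}.
    by rewrite pow2S; case: ifP; lia.
  by rewrite kM.
- move=> [k kM ->].
  change (0 <= p m.+1 k <= 1 /\ iter m.+2 g (p m.+1 k) = 0).
  split; first exact: node01.
  rewrite iterSr map_node //.
  by have [_] : zero_preimage g m.+1 (p m (tent_index m k))
    by apply/IH; exists (tent_index m k) => //; exact: tent_index_le.
Qed.

Lemma cell_exists m x : 0 <= x <= 1 -> exists2 k, (k < 2 ^ m)%N & in_cell g v m k x.
Proof.
move=> /andP[x0 x1].
have : forall n, (n <= 2 ^ m)%N -> x <= p m n ->
    exists2 k, (k < 2 ^ m)%N & in_cell g v m k x.
  elim=> [|n IH] nM xn.
    exists 0%N; first by rewrite expn_gt0.
    move: xn; rewrite /in_cell (proj1 (node_first_last m)) x0 => /= xn.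
    apply: le_trans xn _; rewrite -{1}(proj1 (node_first_last m)) ltW //.
    by apply: node_lt; rewrite ?expn_gt0.
  case: (leP x (p m n)) => [|nx]; first exact/IH/ltnW.
  by exists n => //; rewrite /in_cell xn ltW.
apply; first exact: leqnn.
by rewrite (proj2 (node_first_last m)).
Qed.

Lemma tent_cell_lt m k : (k < 2 ^ m.+1)%N -> (tent_cell m k < 2 ^ m)%N.
Proof. by rewrite /tent_cell pow2S; case: ifP; lia. Qed.

Lemma tent_cell_ends m k : (k < 2 ^ m.+1)%N ->
  (tent_index m k = tent_cell m k /\ tent_index m k.+1 = (tent_cell m k).+1) \/
  (tent_index m k = (tent_cell m k).+1 /\ tent_index m k.+1 = tent_cell m k).
Proof.
rewrite /tent_cell /tent_index pow2S => kM.
case: ltnP => km; [left|right]; last by case: ifP; lia.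
by rewrite ltnW.
Qed.

Lemma cell_image m k x : (k < 2 ^ m.+1)%N ->
  in_cell g v m.+1 k x -> in_cell g v m (tent_cell m k) (g x).
Proof.
move=> kM /andP[kx xk].
have [_ _ _ incg decg] := gv.
have k01 : 0 <= x <= 1.
  have /andP[a0 _] := node01 (ltnW kM); have /andP[_ b1] := node01 kM.
  by rewrite (le_trans a0 kx) (le_trans xk b1).
have inc x1 x2 : lap v false x1 -> lap v false x2 -> x1 <= x2 -> g x1 <= g x2.
  by move=> l1 l2; rewrite le_eqVlt => /orP[/eqP->//|/incg h]; rewrite ltW ?h.
have dec x1 x2 : lap v true x1 -> lap v true x2 -> x1 <= x2 -> g x2 <= g x1.
  by move=> l1 l2; rewrite le_eqVlt => /orP[/eqP->//|/decg h]; rewrite ltW ?h.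
have e0 := map_node (ltnW kM); have e1 := map_node kM.
rewrite /in_cell; case: (ltnP k (2 ^ m)%N) => km.
- have l0 : lap v false (p m.+1 k) by apply: node_lapW => //; lia.
  have l1 : lap v false (p m.+1 k.+1) by apply: node_lapW => //; lia.
  have lx : lap v false x.
    move: l0 l1; rewrite /= !in_itv /= => /andP[? ?] /andP[? ?].
    by apply/andP; split; lra.
  have := inc _ _ l0 lx kx; have := inc _ _ lx l1 xk.
  by rewrite e0 e1 /tent_index /tent_cell km (ltnW km) => -> ->.
- have l0 : lap v true (p m.+1 k) by apply: node_lapW => //; lia.
  have l1 : lap v true (p m.+1 k.+1) by apply: node_lapW => //; lia.
  have lx : lap v true x.
    move: l0 l1; rewrite /= !in_itv /= => /andP[? ?] /andP[? ?].
    by apply/andP; split; lra.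
  have := dec _ _ l0 lx kx; have := dec _ _ lx l1 xk.
  rewrite e0 e1.
  have [[]|[-> ->]] := tent_cell_ends kM; last by move=> -> ->.
  by rewrite /tent_cell /tent_index ltnNge km /= pow2S; case: ifP; lia.
Qed.

End Nodes.

(** * Piecewise linear functions *)

Section PiecewiseLinear.
Context {R : realType}.
Implicit Types (f : R -> R) (a b c t x y : R).

Definition affine_on a b f : Prop :=
  exists al be : R, forall x, a <= x <= b -> f x = al * x + be.

Lemma continuous01_dist f x (e : R) : continuous01 f -> 0 <= x <= 1 -> 0 < e ->
  exists2 d : R, 0 < d & forall y, 0 <= y <= 1 -> `|y - x| < d -> `|f y - f x| < e.
Proof.
move=> /subspace_continuousP fc x01 e0.
have /fc /cvgrPdist_lt /(_ e e0) : `[0, 1]%classic x by rewrite /= in_itv.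
rewrite near_withinE => /nbhs_ballP[d d0 H]; exists d => // y y01 yx.
rewrite distrC; apply: H; last by rewrite /= in_itv.
by rewrite -ball_normE /= distrC.
Qed.

(** Continuity extends an affine formula to the end points; the point y below
    is taken on the way from x to the midpoint of the interval, so close to x
    that neither f nor the affine map varies by more than half of the supposed
    gap. *)
Lemma affine_closure f a b (al be : R) : continuous01 f -> 0 <= a -> a < b -> b <= 1 ->
  (forall x, a < x < b -> f x = al * x + be) ->
  forall x, a <= x <= b -> f x = al * x + be.
Proof.
move=> fc a0 ab b1 faff x /andP[ax xb].
apply/eqP; rewrite -subr_eq0 -normr_le0 leNgt; apply/negP => del0.
set del := `|_| in del0.
have x01 : 0 <= x <= 1 by apply/andP; split; lra.
have [d d0 H] := continuous01_dist fc x01 (divr_gt0 del0 (ltr0Sn R 1)).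
have al0 : 0 < `|al| + 1 by rewrite ltr_pwDr.
pose u := Num.min 1 (Num.min (d / 2) (del / 2 / (`|al| + 1))).
have u0 : 0 < u by rewrite !lt_min ltr01 !divr_gt0.
have u1 : u <= 1 by rewrite !ge_min lexx.
have ud : u <= d / 2 by rewrite !ge_min lexx orbT.
have ual : u * (`|al| + 1) <= del / 2.
  by rewrite -ler_pdivlMr // !ge_min lexx !orbT.
pose y := x + u * ((a + b) / 2 - x).
have ayb : a < y < b.
  by rewrite /y; apply/andP; split; nra.
have yx : `|y - x| <= u.
  by rewrite /y addrAC subrr add0r ler_norml; apply/andP; split; nra.
have : `|f y - f x| < del / 2.
  apply: H; last by lra.
  by move: ayb => /andP[? ?]; apply/andP; split; lra.
rewrite faff // => h1.
have h2 : `|al * (y - x)| < del / 2.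
  rewrite normrM; apply: lt_le_trans ual.
  have := normr_ge0 al; have := normr_ge0 (y - x); nra.
have : del <= `|al * y + be - f x| + `|al * (y - x)|.
  rewrite /del -normrN; have -> : - (f x - (al * x + be)) =
    (al * y + be - f x) - al * (y - x) by ring.
  exact: ler_normB.
lra.
Qed.

Lemma derivable_slope f t : derivable f t 1 ->
  exists l : R, forall e : R, 0 < e -> exists2 d : R, 0 < d &
    forall h : R, h != 0 -> `|h| < d -> `|(f (t + h) - f t) / h - l| < e.
Proof.
move=> /cvg_ex[l /cvgrPdist_lt H]; exists l => e /H.
rewrite near_withinE => /nbhs_ballP[d d0 {}H]; exists d => // h h0 hd.
have := H h; rewrite -ball_normE /= sub0r normrN => /(_ hd h0).
by rewrite distrC [_%:A]mulr1 [h + t]addrC [_ *: _]mulrC.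
Qed.

(** The left and right difference quotients at t are constantly the two slopes,
    so differentiability forces the slopes to agree. *)
Lemma affine_glue f a t c : 0 <= a -> a < t -> t < c -> c <= 1 ->
  derivable f t 1 -> affine_on a t f -> affine_on t c f -> affine_on a c f.
Proof.
move=> a0 at0 tc c1 /derivable_slope[l H] [al [be fl]] [al' [be' fr]].
have ft : f t = al * t + be by apply: fl; rewrite lexx ltW.
have ft' : f t = al' * t + be' by apply: fr; rewrite lexx ltW.
have eal : al = al'.
  apply/eqP; rewrite -subr_eq0 -normr_le0 leNgt; apply/negP => del0.
  have [d d0 {}H] := H _ (divr_gt0 del0 (ltr0Sn R 1)).
  pose h := Num.min (d / 2) (Num.min (t - a) (c - t)).
  have h0 : 0 < h by rewrite !lt_min divr_gt0 // !subr_gt0 at0 tc.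
  have hd : h <= d / 2 by rewrite !ge_min lexx.
  have ha : h <= t - a by rewrite !ge_min lexx !orbT.
  have hc : h <= c - t by rewrite !ge_min lexx !orbT.
  have h00 : h != 0 by rewrite gt_eqF.
  have := H h h00; rewrite gtr0_norm // => /(_ ltac:(lra)).
  rewrite fr; last by apply/andP; split; lra.
  have -> : (al' * (t + h) + be' - f t) / h = al' by rewrite ft'; field.
  have := H (- h); rewrite oppr_eq0 normrN gtr0_norm // => /(_ h00 ltac:(lra)).
  rewrite fl; last by apply/andP; split; lra.
  have -> : (al * (t - h) + be - f t) / - h = al by rewrite ft; field.
  move=> h1 h2.
  have : `|al - al'| <= `|al - l| + `|al' - l|.
    have -> : al - al' = (al - l) - (al' - l) by ring.
    exact: ler_normB.
  lra.
exists al, be => x /andP[ax xc]; case: (leP x t) => xt.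
  by apply: fl; rewrite ax.
rewrite fr; last by rewrite xc ltW.
rewrite -eal; congr (_ + _).
by move: ft; rewrite ft' eal => /addrI.
Qed.

(** Only the finitely many points of the subdivision can obstruct: the affine
    pieces are glued across them one at a time, from left to right. *)
Lemma piecewise_linear_affine_on f : continuous01 f -> piecewise_linear f ->
  exists s : seq R, forall a b, 0 <= a -> a < b -> b <= 1 ->
    (forall t, t \in s -> a < t < b -> derivable f t 1) -> affine_on a b f.
Proof.
move=> fc [s [_ /eqP sl] saff]; exists s => a b a0 ab b1 sder.
pose T i := nth 0 (0 :: s) i.
suff H i : (i <= size s)%N -> forall c, a < c -> c <= b -> c <= T i -> affine_on a c f.
  apply: (H (size s)) => //.
  by rewrite /T -[size s]/((size (0 :: s)).-1) nth_last /= sl.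
elim: i => [|i IH] iS c ac cb cT; first by move: cT; rewrite /T /=; lra.
case: (leP c (T i)) => Tc; first exact: IH (ltnW iS) _ ac cb Tc.
have [al [be faff]] := saff i iS.
case: (leP (T i) a) => aT.
  exists al, be; apply: affine_closure => //; first exact: le_trans b1.
  move=> x /andP[ax xc]; apply: faff; rewrite -/(T i) -/(T i.+1).
  by rewrite (le_lt_trans aT ax) (lt_le_trans xc cT).
apply: (@affine_glue f a (T i) c) => //; first exact: le_trans b1.
- apply: sder; last by rewrite aT (lt_le_trans Tc cb).
  case: i iS {IH cT faff Tc} aT => [|i] iS aT; last by rewrite /T /= mem_nth // ltnW.
  by move: aT; rewrite /T /=; lra.
- apply: IH => //; first exact: ltnW.
  exact: le_trans (ltW Tc) cb.
- exists al, be; apply: affine_closure => //; first by lra.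
    exact: le_trans b1.
  move=> x /andP[ax xc]; apply: faff; rewrite -/(T i) -/(T i.+1).
  by rewrite ax (lt_le_trans xc cT).
Qed.

Lemma affine_derivable f a b x : a < x < b -> affine_on a b f -> derivable f x 1.
Proof.
move=> axb [al [be faff]].
have nf : {near x, (fun y => al * y + be) =1 f}.
  near=> y; rewrite faff //; apply/andP; split; apply: ltW; near: y.
    by apply: lt_nbhsr; case/andP: axb.
  by apply: lt_nbhsl; case/andP: axb.
by apply: (near_eq_derivable nf); apply: derivableD => //; apply: derivableM.
Unshelve. all: by end_near.
Qed.

Lemma increasing_nodes n (a : nat -> R) : (forall k, (k < n)%N -> a k < a k.+1) ->
  forall i j, (i <= j)%N -> (j <= n)%N -> a i <= a j.
Proof.
move=> ainc i j; elim: j => [|j IH]; first by rewrite leqn0 => /eqP ->.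
rewrite leq_eqVlt => /orP[/eqP -> //|]; rewrite ltnS => ij jn.
by apply: le_trans (IH ij (ltnW jn)) (ltW (ainc _ jn)).
Qed.

(** One node is added at a time: the function built so far is frozen beyond
    its last node by a minimum, and the new segment is switched on there by a
    maximum, so that continuity is immediate. *)
Lemma interpolation n (a b : nat -> R) :
  (forall k, (k < n)%N -> a k < a k.+1) -> (forall k, (k < n)%N -> b k < b k.+1) ->
  exists f, [/\ continuous f,
    forall k, (k <= n)%N -> f (a k) = b k,
    forall x y, a 0%N <= x -> x < y -> y <= a n -> f x < f y &
    forall k, (k < n)%N -> affine_on (a k) (a k.+1) f].
Proof.
elim: n => [|n IH] ainc binc.
  exists (fun=> b 0%N); split => //.
  - by move=> x; exact: cst_continuous.
  - by move=> k; rewrite leqn0 => /eqP ->.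
  - by move=> x y; lra.
have [k kn|k kn|f [fc fab finc faff]] := IH; [exact/ainc/ltnW|exact/binc/ltnW|].
have an : a n < a n.+1 by exact: ainc.
have bn : b n < b n.+1 by exact: binc.
pose s := (b n.+1 - b n) / (a n.+1 - a n).
have s0 : 0 < s by rewrite divr_gt0 // subr_gt0.
pose F x := f (Num.min x (a n)) + s * (Num.max x (a n) - a n).
have Fl x : x <= a n -> F x = f x.
  by move=> xa; rewrite /F min_l // max_r // subrr mulr0 addr0.
have Fr x : a n <= x -> F x = b n + s * (x - a n).
  by move=> xa; rewrite /F min_r // max_l // fab.
have a_le := increasing_nodes ainc.
exists F; split.
- move=> x; apply: (@continuousD _ _ _ (fun x => f (Num.min x (a n)))
    (fun x => s * (Num.max x (a n) - a n))).
    apply: (@continuous_comp _ _ _ (fun x => Num.min x (a n)) f); last exact: fc.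
    by apply: (@continuous_min R R id (fun=> a n)); [exact: cvg_id|exact: cvg_cst].
  apply: (@continuousM _ _ (fun=> s)); first exact: cvg_cst.
  apply: (@continuousB _ _ _ (fun x => Num.max x (a n)) (fun=> a n)); last exact: cvg_cst.
  by apply: (@continuous_max R R id (fun=> a n)); [exact: cvg_id|exact: cvg_cst].
- move=> k; rewrite leq_eqVlt => /orP[/eqP ->|].
    rewrite Fr ?(ltW an) // /s mulfVK ?subr_eq0 ?gt_eqF //; ring.
  by rewrite ltnS => kn; rewrite Fl ?fab // a_le.
- have Frinc x y : a n <= x -> x < y -> F x < F y.
    move=> ax xy; rewrite !Fr //; last by exact/ltW/(le_lt_trans ax).
    by rewrite ltrD2l ltr_pM2l // ltrD2r.
  move=> x y ax xy ya; case: (leP (a n) x) => xn; first exact: Frinc.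
  case: (leP y (a n)) => yn; first by rewrite !Fl ?(ltW xn) //; exact: finc.
  apply: (@lt_trans _ _ (F (a n))); last exact: Frinc.
  by rewrite !Fl ?(ltW xn) //; exact: finc.
- move=> k; rewrite ltnS leq_eqVlt => /orP[/eqP ->|kn].
    exists s, (b n - s * a n) => x /andP[ax _]; rewrite Fr //; ring.
  have [al [be h]] := faff k kn; exists al, be => x /andP[ax xa].
  rewrite Fl ?h ?ax //; apply: le_trans xa _; exact: a_le.
Qed.

End PiecewiseLinear.

(** * Shrinking of the cells *)

Section Mesh.
Context {R : realType} {g : R -> R} {v : R} (gv : unimodal_at g v).
Implicit Types (x y r : R) (m k : nat).
Local Notation p := (node g v).

Definition vanishing_mesh (g : R -> R) v : Prop :=
  forall e : R, 0 < e -> exists m, forall k, (k < 2 ^ m)%N ->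
    node g v m k.+1 - node g v m k < e.

Definition affine_on_cells m : Prop :=
  forall k, (k < 2 ^ m)%N -> affine_on (p m k) (p m k.+1) g.

(** The node with odd index 2k+1 at level m+1 is the one that splits cell k of
    level m; both parts are at most r times as long as the cell. *)
Definition split_ratio_le r m k : Prop :=
  p m.+1 k.*2.+1 - p m k <= r * (p m k.+1 - p m k) /\
  p m k.+1 - p m.+1 k.*2.+1 <= r * (p m k.+1 - p m k).

Lemma split_point_between m k : (k < 2 ^ m)%N ->
  p m k < p m.+1 k.*2.+1 < p m k.+1.
Proof.
move=> kM; have M2 : (k.*2.+1 < 2 ^ m.+1)%N by rewrite pow2S; lia.
rewrite -(node_refine gv (ltnW kM)) -(node_refine gv kM) doubleS.
by rewrite !(node_ltS gv) // ltnW.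
Qed.

Lemma split_ratio_lt1 m k : (k < 2 ^ m)%N ->
  exists r, 0 < r < 1 /\ split_ratio_le r m k.
Proof.
move=> kM; have /andP[AC CB] := split_point_between kM; rewrite /split_ratio_le.
move: (p m k) (p m k.+1) (p m.+1 _) AC CB => A B C AC CB.
have AB : 0 < B - A by lra.
have hC : 0 < (C - A) / (B - A) < 1.
  by rewrite divr_gt0 ?ltr_pdivrMr ?mul1r //; lra.
have [e1 e2] : C - A = (C - A) / (B - A) * (B - A) /\
   B - C = (1 - (C - A) / (B - A)) * (B - A) by split; field; lra.
move: ((C - A) / (B - A)) hC e1 e2 => t /andP[t0 t1] -> ->.
exists (Num.max t (1 - t)); rewrite lt_max t0 gt_max t1 !ler_pM2r // !le_max !lexx orbT.
by split=> //; rewrite /=; lra.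
Qed.

Lemma common_ratio (Q : nat -> R -> Prop) n :
  (forall k r r', r <= r' -> Q k r -> Q k r') ->
  (forall k, (k < n)%N -> exists r, 0 < r < 1 /\ Q k r) ->
  exists r, 0 < r < 1 /\ forall k, (k < n)%N -> Q k r.
Proof.
move=> Qmon; elim: n => [|n IH] ex.
  by exists (1 / 2); split => //; apply/andP; split; lra.
have [|r [/andP[r0 r1] Qr]] := IH; first by move=> k kn; apply: ex; exact: ltnW.
have [r' [/andP[r'0 r'1] Qr']] := ex n (leqnn _).
exists (Num.max r r'); rewrite lt_max r0 gt_max r1 r'1; split=> // k.
rewrite ltnS leq_eqVlt => /orP[/eqP ->|/Qr]; last by apply: Qmon; rewrite le_max lexx.
by apply: Qmon Qr'; rewrite le_max lexx orbT.
Qed.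

Lemma split_ratio_le_mono m k r r' : (k < 2 ^ m)%N -> r <= r' ->
  split_ratio_le r m k -> split_ratio_le r' m k.
Proof.
move=> kM rr' [h1 h2]; have AB := node_ltS gv kM.
by split; [apply: (le_trans h1)|apply: (le_trans h2)]; rewrite ler_pM2r ?subr_gt0.
Qed.

Lemma subcell m k : (k < 2 ^ m.+1)%N ->
  p m k./2 <= p m.+1 k /\ p m.+1 k.+1 <= p m k./2.+1.
Proof.
rewrite pow2S => kM.
have jM : (k./2 < 2 ^ m)%N by lia.
rewrite -(node_refine gv (ltnW jM)) -(node_refine gv jM).
by rewrite !(node_le gv) ?pow2S; try split; lia.
Qed.

Lemma affine_on_cellsW N m : (N <= m)%N -> affine_on_cells N -> affine_on_cells m.
Proof.
move=> /subnKC <-; elim: (m - N)%N => [|d IH] aff; first by rewrite addn0.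
rewrite addnS => k kM; have [|al [be h]] := IH aff k./2.
  by move: kM; rewrite pow2S; lia.
have [l r] := subcell kM; exists al, be => x /andP[lx xr]; apply: h.
by rewrite (le_trans l lx) (le_trans xr r).
Qed.

(** An affine map preserves ratios, and it sends the cell and its splitting
    node to a cell one level below and the splitting node of that cell. *)
Lemma split_ratio_pullback m k r : (k < 2 ^ m.+1)%N ->
  affine_on (p m.+1 k) (p m.+1 k.+1) g ->
  split_ratio_le r m (tent_cell m k) -> split_ratio_le r m.+1 k.
Proof.
move=> kM [al [be aff]].
have /andP[AC CB] := split_point_between kM.
have M2 : (k.*2.+1 <= 2 ^ m.+2)%N by move: kM; rewrite [(2 ^ m.+2)%N]pow2S; lia.
have gA := map_node gv (ltnW kM); have gB := map_node gv kM.
have gC := map_node gv M2.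
have eC : tent_index m.+1 k.*2.+1 = (tent_cell m k).*2.+1.
  move: kM; rewrite /tent_index /tent_cell !pow2S.
  by case: ifP; case: ifP; lia.
rewrite aff ?lexx ?ltW ?(lt_trans AC CB) // in gA.
rewrite aff ?lexx ?ltW ?(lt_trans AC CB) // in gB.
rewrite aff ?ltW // eC in gC.
have jM := tent_cell_lt kM.
have /andP[AC' CB'] := split_point_between jM.
rewrite /split_ratio_le -gC.
rewrite -gC in AC' CB'.
have [[eA eB]|[eA eB]] := tent_cell_ends kM;
  rewrite eA in gA; rewrite eB in gB; rewrite -gA -gB in AC' CB' *;
  move: AC CB AC' CB' {gA gB gC aff};
  move: (p m.+1 k) (p m.+1 k.+1) (p m.+2 _) => A B C AC CB AC' CB' [h1 h2].
- have al0 : 0 < al.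
    have CA : 0 < C - A by lra.
    by rewrite -(pmulr_lgt0 _ CA) mulrC; lra.
  by split; rewrite -(ler_pM2l al0); lra.
- have al0 : 0 < - al.
    have CA : 0 < C - A by lra.
    by rewrite -(pmulr_lgt0 _ CA) mulrC; lra.
  by split; rewrite -(ler_pM2l al0); lra.
Qed.

(** Levels up to N contain finitely many cells, and the ratios of the later
    levels are inherited from them. *)
Lemma split_ratio_bound N : affine_on_cells N ->
  exists r, 0 < r < 1 /\ forall m k, (k < 2 ^ m)%N -> split_ratio_le r m k.
Proof.
move=> aff.
have [|m mN|r [r01 H]] := @common_ratio
    (fun m r => forall k, (k < 2 ^ m)%N -> split_ratio_le r m k) N.+1.
- by move=> m r r' rr' h k kM; apply: split_ratio_le_mono (h _ kM).
- have [||r [r01 H]] := @common_ratio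
    (fun k r => (k < 2 ^ m)%N -> split_ratio_le r m k) (2 ^ m)%N.
  + by move=> k r r' rr' h kM; apply: split_ratio_le_mono (h kM).
  + by move=> k kM; have [r [r01 h]] := split_ratio_lt1 kM; exists r.
  + by exists r; split => // k kM; exact: H.
exists r; split => //; elim=> [|m IH] k kM; first exact: H.
case: (ltnP m N) => mN; first exact: H.
apply: split_ratio_pullback => //; last by apply: IH; exact: tent_cell_lt.
exact: (affine_on_cellsW (leqW mN) aff).
Qed.

(** A common ratio r < 1 makes the cells of level m shorter than r^m. *)
Lemma affine_vanishing_mesh N : affine_on_cells N -> vanishing_mesh g v.
Proof.
move=> /split_ratio_bound[r [/andP[r0 r1] H]] e e0.
have len m k : (k < 2 ^ m)%N -> p m k.+1 - p m k <= r ^+ m.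
  elim: m k => [|m IH] k kM.
    move: kM; rewrite expn0; case: k => // _.
    by rewrite !node0 mulr0n mulr1n subr0 expr0.
  have jM : (k./2 < 2 ^ m)%N by move: kM; rewrite pow2S; lia.
  have [h1 h2] := H _ _ jM.
  have {}IH : r * (p m k./2.+1 - p m k./2) <= r ^+ m.+1.
    by rewrite exprS ler_pM2l // IH.
  rewrite -{1}(node_refine gv (ltnW jM)) in h1.
  rewrite -{1}(node_refine gv jM) in h2.
  rewrite -[k]odd_double_half; case: (odd k); rewrite /= ?add1n ?add0n.
    by rewrite -doubleS; apply: le_trans IH.
  exact: le_trans IH.
have : r ^+ n @[n --> \oo] --> 0 by apply: cvg_expr; rewrite gtr0_norm.
move=> /cvgrPdist_lt /(_ _ e0) [M _ hM]; exists M => k kM.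
apply: le_lt_trans (len _ _ kM) _.
by have := hM M (leqnn _); rewrite /= sub0r normrN gtr0_norm // exprn_gt0.
Qed.

End Mesh.

(** * The conjugacy given by the position among the nodes *)

Section CellMaps.
Context {R : realType}.
Implicit Types (g h : R -> R) (v x y : R) (m k : nat).

Definition cell_map g1 v1 g2 v2 h : Prop :=
  forall m k x, (k < 2 ^ m)%N -> in_cell g1 v1 m k x -> in_cell g2 v2 m k (h x).

(** The nodes of the first map below x, transported to the second map, have
    this supremum; when the cells shrink it is the point with the same position
    among the nodes as x. *)
Definition address_map g1 v1 g2 v2 x : R :=
  sup [set y | exists m k,
    [/\ (k <= 2 ^ m)%N, node g1 v1 m k <= x & y = node g2 v2 m k]].

(** Written as dyadic fractions k / 2^m, nodes of different levels compare as
    their indices do; in particular in the same way for all unimodal maps. *)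
Lemma node_le_levels g v m k m' k' : unimodal_at g v ->
  (k <= 2 ^ m)%N -> (k' <= 2 ^ m')%N ->
  (node g v m k <= node g v m' k') = (2 ^ m' * k <= 2 ^ m * k')%N.
Proof.
move=> gv kM kM'.
rewrite -(node_refine_iter gv m' kM) -(node_refine_iter gv m kM') [(m' + m)%N]addnC.
rewrite (node_le gv) // expnD; last by rewrite leq_mul2l kM' orbT.
by rewrite mulnC leq_mul2r kM orbT.
Qed.

Lemma in_cell01 g v m k x : unimodal_at g v -> (k < 2 ^ m)%N ->
  in_cell g v m k x -> 0 <= x <= 1.
Proof.
move=> gv kM /andP[kx xk].
have /andP[a0 _] := node01 gv (ltnW kM); have /andP[_ b1] := node01 gv kM.
by rewrite (le_trans a0 kx) (le_trans xk b1).
Qed.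

Lemma address_cell_map g1 v1 g2 v2 : unimodal_at g1 v1 -> unimodal_at g2 v2 ->
  cell_map g1 v1 g2 v2 (address_map g1 v1 g2 v2).
Proof.
move=> gv1 gv2 m k x kM /andP[kx xk].
set E := [set y | exists m k,
    [/\ (k <= 2 ^ m)%N, node g1 v1 m k <= x & y = node g2 v2 m k]].
have Ek : E (node g2 v2 m k) by exists m, k; split => //; exact: ltnW.
have Eub : ubound E (node g2 v2 m k.+1).
  move=> _ [m' [k' [kM' kx' ->]]].
  have := le_trans kx' xk.
  by rewrite (node_le_levels gv1) // (node_le_levels gv2).
apply/andP; split; last by apply: ge_sup => //; exists (node g2 v2 m k).
by apply: ub_le_sup => //; exists (node g2 v2 m k.+1).
Qed.

Lemma cell_map01 g1 v1 g2 v2 h x : unimodal_at g1 v1 -> unimodal_at g2 v2 ->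
  cell_map g1 v1 g2 v2 h -> 0 <= x <= 1 -> 0 <= h x <= 1.
Proof.
move=> gv1 gv2 hc /(cell_exists gv1 0)[k kM xk].
exact: in_cell01 gv2 kM (hc _ _ _ kM xk).
Qed.

Lemma same_cells_eq g v x y : vanishing_mesh g v ->
  (forall m, exists k, [/\ (k < 2 ^ m)%N, in_cell g v m k x & in_cell g v m k y]) ->
  x = y.
Proof.
move=> mesh same; apply/eqP; rewrite -subr_eq0 -normr_le0 leNgt; apply/negP.
move=> /mesh[m H]; have [k [/H kM /andP[kx xk] /andP[ky yk]]] := same m.
have : `|x - y| <= node g v m k.+1 - node g v m k.
  by rewrite ler_norml; apply/andP; split; lra.
by rewrite leNgt kM.
Qed.

(** Going forth and back leaves the point in its cell at every level. *)
Lemma cell_map_cancel g1 v1 g2 v2 h h' : unimodal_at g1 v1 ->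
  vanishing_mesh g1 v1 -> cell_map g1 v1 g2 v2 h -> cell_map g2 v2 g1 v1 h' ->
  {in `[0, 1], cancel h h'}.
Proof.
move=> gv1 mesh hc hc' x; rewrite in_itv /= => x01.
apply: (same_cells_eq mesh) => m; have [k kM xk] := cell_exists gv1 m x01.
by exists k; split => //; apply: hc' => //; exact: hc.
Qed.

(** Both sides lie in the image of the cell of the next level that contains
    x. *)
Lemma cell_map_semiconj g1 v1 g2 v2 h : unimodal_at g1 v1 -> unimodal_at g2 v2 ->
  vanishing_mesh g2 v2 -> cell_map g1 v1 g2 v2 h -> semiconj01 h g1 g2.
Proof.
move=> gv1 gv2 mesh hc x; rewrite in_itv /= => x01.
apply: (same_cells_eq mesh) => m; have [k kM xk] := cell_exists gv1 m.+1 x01.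
have jM := tent_cell_lt kM; exists (tent_cell m k); split => //.
  by apply: hc => //; exact: cell_image.
by apply: cell_image => //; exact: hc.
Qed.

Lemma address_map_le g1 v1 g2 v2 x y : unimodal_at g1 v1 -> unimodal_at g2 v2 ->
  0 <= x -> x <= y -> address_map g1 v1 g2 v2 x <= address_map g1 v1 g2 v2 y.
Proof.
move=> gv1 gv2 x0 xy; apply: ge_sup.
  exists (node g2 v2 0 0); by exists 0%N, 0%N.
move=> _ [m [k [kM kx ->]]]; apply: ub_le_sup.
  by exists 1 => _ [m' [k' [kM' _ ->]]]; have /andP[] := node01 gv2 kM'.
by exists m, k; split => //; exact: le_trans xy.
Qed.

(** A monotone surjection between intervals is continuous, and surjectivity
    comes from the address map in the opposite direction. *)
Lemma address_continuous g1 v1 g2 v2 : unimodal_at g1 v1 -> unimodal_at g2 v2 ->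
  vanishing_mesh g1 v1 -> vanishing_mesh g2 v2 ->
  continuous01 (address_map g1 v1 g2 v2).
Proof.
move=> gv1 gv2 mesh1 mesh2.
set h := address_map _ _ _ _; set h' := address_map g2 v2 g1 v1.
have hc := address_cell_map gv1 gv2; have hc' := address_cell_map gv2 gv1.
have hK := cell_map_cancel gv1 mesh1 hc hc'.
have hK' := cell_map_cancel gv2 mesh2 hc' hc.
have h01 x := cell_map01 gv1 gv2 hc (x := x).
have h01' x := cell_map01 gv2 gv1 hc' (x := x).
apply: segment_inc_surj_continuous.
  move=> x y xI yI; have := xI; have := yI.
  rewrite !in_itv /= => /andP[y0 y1] /andP[x0 x1].
  apply/idP/idP => [hxy|]; last exact: address_map_le.
  rewrite leNgt; apply/negP => yx.
  have hyx : h y <= h x by apply: address_map_le => //; exact: ltW.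
  have e : h x = h y by apply/le_anti; rewrite hxy hyx.
  by have := hK _ xI; rewrite -/h e hK // => exy; rewrite exy ltxx in yx.
move=> y; rewrite /= in_itv /= => /andP[hy yh].
have y01 : 0 <= y <= 1.
  have /andP[h00 _] : 0 <= h 0 <= 1 by apply: h01; rewrite lexx ler01.
  have /andP[_ h11] : 0 <= h 1 <= 1 by apply: h01; rewrite lexx ler01.
  by rewrite (le_trans h00 hy) (le_trans yh h11).
exists (h' y); first by rewrite /= in_itv /= h01'.
by apply: hK'; rewrite in_itv.
Qed.

Lemma address_homeomorphism g1 v1 g2 v2 : unimodal_at g1 v1 -> unimodal_at g2 v2 ->
  vanishing_mesh g1 v1 -> vanishing_mesh g2 v2 ->
  homeomorphism01 (address_map g1 v1 g2 v2).
Proof.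
move=> gv1 gv2 mesh1 mesh2.
have hc := address_cell_map gv1 gv2; have hc' := address_cell_map gv2 gv1.
split.
- by move=> x; rewrite /= !in_itv /=; apply: cell_map01 (address_cell_map _ _).
- exact: address_continuous.
exists (address_map g2 v2 g1 v1); split.
- by move=> x; rewrite /= !in_itv /=; apply: cell_map01 (address_cell_map _ _).
- exact: address_continuous.
- exact: cell_map_cancel hc hc'.
- exact: cell_map_cancel hc' hc.
Qed.

Lemma address_semiconj g1 v1 g2 v2 : unimodal_at g1 v1 -> unimodal_at g2 v2 ->
  vanishing_mesh g2 v2 -> semiconj01 (address_map g1 v1 g2 v2) g1 g2.
Proof.
move=> gv1 gv2 mesh2.
exact: (cell_map_semiconj gv1 gv2 mesh2 (address_cell_map gv1 gv2)).
Qed.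

Lemma conjugate_of_vanishing_mesh g1 v1 g2 v2 :
  unimodal_at g1 v1 -> unimodal_at g2 v2 ->
  vanishing_mesh g1 v1 -> vanishing_mesh g2 v2 -> topologically_conjugate g1 g2.
Proof.
move=> gv1 gv2 mesh1 mesh2; exists (address_map g1 v1 g2 v2).
  exact: address_homeomorphism.
exact: address_semiconj.
Qed.

(** For n > m the function hn n still matches the nodes of level m, since they
    are nodes of level n - 1; being increasing, it keeps x in its cell. *)
Lemma node_matching_cvg g1 v1 g2 v2 (hn : nat -> R -> R) x :
  unimodal_at g1 v1 -> unimodal_at g2 v2 -> vanishing_mesh g2 v2 ->
  (forall m, strictly_increasing_on `[0, 1] (hn m.+1)) ->
  (forall m k, (k <= 2 ^ m)%N -> hn m.+1 (node g1 v1 m k) = node g2 v2 m k) ->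
  0 <= x <= 1 -> hn n x @[n --> \oo] --> address_map g1 v1 g2 v2 x.
Proof.
move=> gv1 gv2 mesh2 hinc hnode x01; apply/cvgrPdist_lt => e /mesh2[m H].
have [k kM xk] := cell_exists gv1 m x01.
have /andP[kh hk] := address_cell_map gv1 gv2 kM xk.
exists m.+1 => // -[//|n] /=; rewrite ltnS => /subnKC nE.
have hle y z : 0 <= y <= 1 -> 0 <= z <= 1 -> y <= z -> hn n.+1 y <= hn n.+1 z.
  move=> y01 z01; rewrite le_eqVlt => /orP[/eqP -> //|/hinc]; rewrite /= !in_itv /=.
  by move=> h; apply/ltW/h.
have hnodem i : (i <= 2 ^ m)%N -> hn n.+1 (node g1 v1 m i) = node g2 v2 m i.
  move=> iM; rewrite -(node_refine_iter gv1 (n - m) iM).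
  rewrite -(node_refine_iter gv2 (n - m) iM).
  rewrite nE; apply: hnode; rewrite -[in (2 ^ n)%N]nE expnD mulnC.
  by rewrite leq_mul2r iM orbT.
move: xk => /andP[kx xk].
have := hle _ _ (node01 gv1 (ltnW kM)) x01 kx.
have := hle _ _ x01 (node01 gv1 kM) xk.
rewrite !hnodem //; last exact: ltnW.
move=> h1 h2; apply: le_lt_trans (H _ kM).
by rewrite ler_norml; apply/andP; split; lra.
Qed.

End CellMaps.

(** * Firm carcass maps, the tent map and the approximating maps *)

Section FirmCarcassMaps.
Context {R : realType}.
Implicit Types (g h f : R -> R) (v x y a b : R) (m k : nat).

(** Finitely many kinks have a common level, as nodes persist. *)
Lemma finite_node_level g v (s : seq R) : unimodal_at g v ->
  (forall t, t \in s -> kink g t -> complete_zero_preimage g t) ->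
  exists N, forall t, t \in s -> kink g t ->
    exists2 k, (k <= 2 ^ N)%N & t = node g v N k.
Proof.
move=> gv; elim: s => [|t s IH] firm; first by exists 0%N.
have [|N HN] := IH; first by move=> u us; apply: firm; rewrite inE us orbT.
have [M HM] : exists M, kink g t -> exists2 k, (k <= 2 ^ M)%N & t = node g v M k.
  have [kt|nkt] := pselect (kink g t); last by exists 0%N.
  have [|[|M] //= _] := firm t _ kt; first by rewrite inE eqxx.
  by move=> /(zero_preimage_nodes gv)[k kM tk]; exists M => _; exists k.
have raise L d u : (exists2 k, (k <= 2 ^ L)%N & u = node g v L k) ->
    exists2 k, (k <= 2 ^ (L + d))%N & u = node g v (L + d) k.
  move=> [k kL ->]; exists (2 ^ d * k)%N; last by rewrite node_refine_iter.
  by rewrite expnD mulnC leq_mul2r kL orbT.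
exists (N + M)%N => u; rewrite inE => /orP[/eqP ->|us] ku.
  by rewrite addnC; apply: raise; exact: HM.
by apply: raise; exact: HN.
Qed.

Lemma derivable_in_cell g v m k f t : unimodal_at g v -> (k < 2 ^ m)%N ->
  (kink f t -> exists2 j, (j <= 2 ^ m)%N & t = node g v m j) ->
  node g v m k < t < node g v m k.+1 -> derivable f t 1.
Proof.
move=> gv kM knode /andP[at0 tb]; apply: contrapT => nder.
have /andP[a0 _] := node01 gv (ltnW kM); have /andP[_ b1] := node01 gv kM.
have t01 : 0 < t < 1 by rewrite (le_lt_trans a0 at0) (lt_le_trans tb b1).
have [j jM tj] := knode (conj t01 nder).
move: at0 tb; rewrite tj !ltNge !(node_le gv) //; last exact: ltnW.
by rewrite -!ltnNge ltnS => ? ?; lia.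
Qed.

Lemma firm_vanishing_mesh g : firm_carcass_map g ->
  exists v, unimodal_at g v /\ vanishing_mesh g v.
Proof.
move=> [[/unimodalP[v gv] gpl] firm]; exists v; split => //.
have [_ gc _ _ _] := gv.
have [s Hs] := piecewise_linear_affine_on gc gpl.
have [N HN] := finite_node_level gv (fun t (_ : t \in s) => firm t).
apply: (@affine_vanishing_mesh _ _ _ gv N) => k kM.
have /andP[a0 _] := node01 gv (ltnW kM); have /andP[_ b1] := node01 gv kM.
apply: Hs => //; first exact: node_ltS.
move=> t ts; apply: derivable_in_cell (HN t ts) => //.
Qed.

Lemma tent_unimodal_at : unimodal_at (@tent R) (1 / 2).
Proof.
have tl x : x <= 1 / 2 -> tent x = 2 * x by rewrite /tent => ->.
have tr x : 1 / 2 <= x -> tent x = 2 - 2 * x.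
  rewrite /tent le_eqVlt => /orP[/eqP <-|]; first by rewrite lexx; field.
  by move=> h; rewrite leNgt h.
have tminE x : Num.min (2 * x) (2 - 2 * x) = tent x.
  by case: (leP x (1 / 2)) => h; [rewrite tl // min_l|rewrite tr ?(ltW h) // min_r]; lra.
split.
- move=> x; rewrite /= !in_itv /= => /andP[x0 x1]; apply/andP.
  by case: (leP x (1 / 2)) => h; [rewrite tl //|rewrite tr ?(ltW h) //]; split; lra.
- apply: continuous_subspaceT => x.
  rewrite (_ : @tent R = (fun x => Num.min (2 * x) (2 - 2 * x))); last first.
    by apply/funext => y; rewrite tminE.
  have c2 : {for x, continuous (fun y : R => 2 * y)}.
    by apply: (@continuousM _ _ (fun=> 2)); [exact: cvg_cst|exact: cvg_id].
  apply: (@continuous_min R R (fun y => 2 * y) (fun y => 2 - 2 * y)) => //.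
  by apply: (@continuousB _ _ _ (fun=> 2 : R) (fun y => 2 * y)) => //; exact: cvg_cst.
- split; first by apply/andP; split; lra.
  by split; [rewrite tl|rewrite tr|rewrite tl]; lra.
- move=> x y; rewrite /= !in_itv /= => /andP[? ?] /andP[? ?] xy.
  by rewrite !tl //; lra.
- move=> x y; rewrite /= !in_itv /= => /andP[? ?] /andP[? ?] xy.
  by rewrite !tr //; lra.
Qed.

(** The cells of level 1 are the two laps of the tent map. *)
Lemma tent_vanishing_mesh : vanishing_mesh (@tent R) (1 / 2).
Proof.
have tv := tent_unimodal_at.
have n0 := proj1 (node_first_last tv 1).
have n1 : node (@tent R) (1 / 2) 1 1 = 1 / 2 := node_middle tv 0.
have n2 : node (@tent R) (1 / 2) 1 2 = 1 := proj2 (node_first_last tv 1).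
apply: (@affine_vanishing_mesh _ _ _ tv 1); rewrite /affine_on_cells expn1 => -[|[|//]] _.
- rewrite n0 n1; exists 2, 0 => x /andP[_ h].
  by rewrite /tent h addr0.
- rewrite n1 n2; exists (- 2), 2 => x /andP[+ _].
  rewrite /tent le_eqVlt => /orP[/eqP <-|h]; first by rewrite lexx; field.
  by rewrite leNgt h /= addrC mulNr.
Qed.

(** A strictly increasing self-map of {0, ..., M}, given by its graph, moves no
    index down and, counting from the top, none up. *)
Lemma order_embedding_id M (Q : nat -> nat -> Prop) :
  (forall i, (i <= M)%N -> exists2 j, (j <= M)%N & Q i j) ->
  (forall i i' j j', Q i j -> Q i' j' -> (i < i')%N -> (j < j')%N) ->
  forall i, (i <= M)%N -> Q i i.
Proof.
move=> tot inc.
have ge i j : (i <= M)%N -> Q i j -> (i <= j)%N.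
  elim: i j => // i IH j iM qij.
  have [j' _ qj'] := tot i (ltnW iM).
  exact: leq_ltn_trans (IH _ (ltnW iM) qj') (inc _ _ _ _ qj' qij (ltnSn i)).
have le d i j : (i + d = M)%N -> (j <= M)%N -> Q i j -> (j + d <= M)%N.
  elim: d i j => [|d IH] i j iM jM qij; first by rewrite addn0.
  have [|j' j'M qj'] := tot i.+1; first by lia.
  have := inc _ _ _ _ qij qj' (ltnSn i).
  by have := IH i.+1 j' _ j'M qj'; lia.
move=> i iM; have [j jM qij] := tot i iM.
suff ji : j = i by rewrite -{2}ji.
by have := ge _ _ iM qij; have := le (M - i)%N _ _ (subnKC iM) jM qij; lia.
Qed.

(** An increasing map that sends the nodes of one map to those of the other
    induces an increasing self-map of the indices, hence the identity. *)
Lemma approx_conj_node g1 v1 g2 v2 m h :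
  unimodal_at g1 v1 -> unimodal_at g2 v2 -> approx_conj g1 g2 m.+1 h ->
  forall k, (k <= 2 ^ m)%N -> h (node g1 v1 m k) = node g2 v2 m k.
Proof.
move=> gv1 gv2 [_ hinc _ himg _] k kM.
pose Q i j := [/\ (i <= 2 ^ m)%N, (j <= 2 ^ m)%N &
  h (node g1 v1 m i) = node g2 v2 m j].
have [] // : Q k k.
apply: (@order_embedding_id (2 ^ m)) => // {k kM}.
- move=> i iM; have /(zero_preimage_nodes gv2)[j jM e] :
      zero_preimage g2 m.+1 (h (node g1 v1 m i)).
    rewrite -himg; exists (node g1 v1 m i) => //.
    by apply/(zero_preimage_nodes gv1); exists i.
  by exists j.
- move=> i i' j j' [iM jM e] [iM' jM' e'] ii'.
  have : h (node g1 v1 m i) < h (node g1 v1 m i').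
    by apply: hinc; rewrite /= ?in_itv /= ?(node01 gv1) // (node_lt gv1).
  by rewrite e e' ltNge (node_le gv2) // -ltnNge.
Qed.

Lemma affine_on_ends a b f h : a < b -> affine_on a b f -> affine_on a b h ->
  f a = h a -> f b = h b -> forall x, a <= x <= b -> f x = h x.
Proof.
move=> ab [al [be ef]] [al' [be' eh]].
have aI : a <= a <= b by rewrite lexx ltW.
have bI : a <= b <= b by rewrite lexx ltW.
rewrite !ef ?eh // => ea eb x xI; rewrite ef // eh //.
have eal : al = al'.
  have ab0 : b - a != 0 by rewrite gt_eqF // subr_gt0.
  by apply: (mulIf ab0); lra.
by move: ea; rewrite eal => /addrI ->.
Qed.

Lemma approx_conj_affine g1 v1 g2 m h : unimodal_at g1 v1 ->
  approx_conj g1 g2 m.+1 h ->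
  forall k, (k < 2 ^ m)%N -> affine_on (node g1 v1 m k) (node g1 v1 m k.+1) h.
Proof.
move=> gv1 [[_ hc] _ /(piecewise_linear_affine_on hc)[s Hs] _ hk] k kM.
have /andP[a0 _] := node01 gv1 (ltnW kM); have /andP[_ b1] := node01 gv1 kM.
apply: Hs => //; first exact: node_ltS.
by move=> t _; apply: derivable_in_cell => // /hk /(zero_preimage_nodes gv1).
Qed.

Lemma approx_conj_unique g1 v1 g2 v2 m h h' :
  unimodal_at g1 v1 -> unimodal_at g2 v2 ->
  approx_conj g1 g2 m.+1 h -> approx_conj g1 g2 m.+1 h' -> {in `[0, 1], h =1 h'}.
Proof.
move=> gv1 gv2 ah ah' x; rewrite in_itv /= => /(cell_exists gv1 m)[k kM xk].
apply: (affine_on_ends (node_ltS gv1 kM) (approx_conj_affine gv1 ah kM)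
  (approx_conj_affine gv1 ah' kM)) xk;
  by rewrite (approx_conj_node gv1 gv2 ah) ?(approx_conj_node gv1 gv2 ah') // ltnW.
Qed.

Lemma approx_conj_exists g1 v1 g2 v2 m :
  unimodal_at g1 v1 -> unimodal_at g2 v2 -> exists h, approx_conj g1 g2 m.+1 h.
Proof.
move=> gv1 gv2.
have [h [hc hnode hinc haff]] := @interpolation _ (2 ^ m) (node g1 v1 m) (node g2 v2 m)
  (@node_ltS _ _ _ gv1 m) (@node_ltS _ _ _ gv2 m).
have [p10 p11] := node_first_last gv1 m; have [p20 p21] := node_first_last gv2 m.
have {}hinc : strictly_increasing_on `[0, 1] h.
  move=> x y; rewrite /= !in_itv /= => /andP[x0 _] /andP[_ y1] xy.
  by apply: hinc; rewrite ?p10 ?p11.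
have hc01 : continuous01 h by exact: continuous_subspaceT.
have h0 : h 0 = 0 by rewrite -p10 hnode // p10 p20.
have h1 : h 1 = 1 by rewrite -p11 hnode // p11 p21.
exists h; split => //.
- split => // x; rewrite /= !in_itv /= => /andP[x0 x1]; apply/andP; split.
    move: x0; rewrite le_eqVlt => /orP[/eqP <-|x0]; first by rewrite h0.
    by rewrite -h0 ltW // hinc //= in_itv /= ?lexx ?ler01 // x1 ltW.
  move: x1; rewrite le_eqVlt => /orP[/eqP ->|x1]; first by rewrite h1.
  by rewrite -h1 ltW // hinc //= in_itv /= ?lexx ?ler01 // x0 ltW.
- pose s := [seq node g1 v1 m k | k <- iota 1 (2 ^ m)].
  have ss : size s = (2 ^ m)%N by rewrite size_map size_iota.
  have nths i : (i <= 2 ^ m)%N -> nth 0 (0 :: s) i = node g1 v1 m i.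
    case: i => [|i] iM; first by rewrite /= p10.
    by rewrite /= (nth_map 0%N) ?size_iota // nth_iota.
  exists s.
    split.
      apply/(pathP 0) => i; rewrite ss => iM.
      rewrite nths; last exact: ltnW.
      by rewrite -[nth 0 s i]/(nth 0 (0 :: s) i.+1) nths // node_ltS.
    rewrite -[last 0 s]/(last 0 (0 :: s)) -nth_last.
    by rewrite -[X in nth _ _ X]/(size s) ss (nths _ (leqnn _)) p11.
  move=> i; rewrite ss => iM; have [al [be H]] := haff i iM.
  exists al, be => x; rewrite !nths // ?(ltnW iM) // => /andP[? ?].
  by apply: H; rewrite !ltW.
- apply/seteqP; split => [_ [x /(zero_preimage_nodes gv1)[k kM ->] <-]|y].
    by apply/(zero_preimage_nodes gv2); exists k => //; exact: hnode.
  move=> /(zero_preimage_nodes gv2)[k kM ->]; exists (node g1 v1 m k); last exact: hnode.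
  by apply/(zero_preimage_nodes gv1); exists k.
- move=> x [/andP[x0 x1] nder]; apply/(zero_preimage_nodes gv1).
  have x01 : 0 <= x <= 1 by rewrite !ltW.
  have [k kM /andP[kx xk]] := cell_exists gv1 m x01.
  move: kx; rewrite le_eqVlt => /orP[/eqP <-|kx]; first by exists k => //; exact: ltnW.
  move: xk; rewrite le_eqVlt => /orP[/eqP ->|xk]; first by exists k.+1.
  by case: nder; apply: affine_derivable (haff k kM); rewrite kx xk.
Qed.

End FirmCarcassMaps.

Unset Implicit Arguments.
Set Strict Implicit.

Theorem mainTheorem2 (R : realType) (g1 g2 : R -> R)
  (hg1 : firm_carcass_map g1) (hg2 : firm_carcass_map g2) :
  [/\ topologically_conjugate g1 g2,
      topologically_conjugate g1 (@tent R) /\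
      topologically_conjugate g2 (@tent R),
      forall n : nat, (1 <= n)%N ->
        exists2 hn : R -> R, approx_conj g1 g2 n hn &
          forall k : R -> R, approx_conj g1 g2 n k ->
            {in `[0, 1], k =1 hn} &
      forall hn : nat -> R -> R,
        (forall n : nat, (1 <= n)%N -> approx_conj g1 g2 n (hn n)) ->
        exists h : R -> R,
          [/\ forall x : R, x \in `[0, 1] -> hn n x @[n --> \oo] --> h x,
              homeomorphism01 h &
              semiconj01 h g1 g2]].
Proof.
have [v1 [gv1 mesh1]] := firm_vanishing_mesh hg1.
have [v2 [gv2 mesh2]] := firm_vanishing_mesh hg2.
have tv := tent_unimodal_at (R := R); have tmesh := tent_vanishing_mesh (R := R).
split.
- exact: conjugate_of_vanishing_mesh gv1 gv2 mesh1 mesh2.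
- split; first exact: conjugate_of_vanishing_mesh gv1 tv mesh1 tmesh.
  exact: conjugate_of_vanishing_mesh gv2 tv mesh2 tmesh.
- move=> [//|m] _; have [h ah] := approx_conj_exists m gv1 gv2.
  by exists h => // k ak; exact: approx_conj_unique gv1 gv2 ak ah.
- move=> hn ahn; exists (address_map g1 v1 g2 v2); split.
  + move=> x; rewrite in_itv /= => x01; apply: node_matching_cvg => //.
      by move=> m; have [] := ahn m.+1 isT.
    by move=> m k kM; exact: (approx_conj_node gv1 gv2 (ahn m.+1 isT)).
  + exact: address_homeomorphism.
  + exact: address_semiconj.
Qed.
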